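(* Let $F, D, Q \in \mathbb{C}^{m\times m}$, where $D$ and $Q$ are hermitian, $D \ge 0$ (positive semidefinite), and the pair $(F,D)$ is controllable. Let $$H = \begin{pmatrix} F & -D \\ -Q & -F^* \end{pmatrix} \in \mathbb{C}^{2m\times 2m},$$ and assume $\sigma(H) = \{0\}$. Let $s^{2m_1}, \dots, s^{2m_k}$ be the elementary divisors of $H$. Set $$W = \bigl(\operatorname{Im} H^{m_1} \cap \operatorname{Ker} H^{m_1}\bigr) + \cdots + \bigl(\operatorname{Im} H^{m_k} \cap \operatorname{Ker} H^{m_k}\bigr).$$ Then $W$ is an $H$-invariant subspace of $\mathbb{C}^{2m}$ and $\dim W = m$. Let $Y, Z \in \mathbb{C}^{m\times m}$ be such that the columns of $\begin{pmatrix} Y \\ Z\end{pmatrix}$ are a basis of $W$. Then $Y$ is nonsingular and $X = ZY^{-1}$ is the unique hermitian solution of the algebraic Riccati equation $$Q + F^*X + XF - XDX = 0 .$$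
   Context: $\sigma(H)$ denotes the spectrum of $H$, and $F^*$ the conjugate transpose of $F$. The pair $(F,D)$ is controllable if the $m \times m^2$ matrix $(D, FD, \dots, F^{m-1}D)$ has rank $m$. The elementary divisors of $H$ are the polynomials $s^{d}$, one for each Jordan block of $H$ (all with eigenvalue $0$), $d$ being the block size; here all have even degree and are written $s^{2m_1},\dots,s^{2m_k}$. *)

(* Defs.v *)
From HB Require Import structures.
From mathcomp Require Import all_boot all_order all_algebra.
From mathcomp Require Import complex.
From mathcomp Require Import reals.

Set Implicit Arguments.
Unset Strict Implicit.
Unset Printing Implicit Defensive.

Import Order.TTheory GRing.Theory Num.Theory.
Local Open Scope ring_scope.
Local Open Scope sesquilinear_scope.

Section JordanForm.
Variable F : fieldType.

Definition jordan_block (a : F) (d : nat) : 'M[F]_d :=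
  \matrix_(i < d, j < d) (a *+ (i == j) + (i.+1 == j :> nat)%:R).

(* In [s], a pair [(a, d)] stands for a Jordan block of size [d] with
   eigenvalue [a]. *)
Definition jordan_size (s : seq (F * nat)) (i : 'I_(size s)) : nat :=
  (nth (0, 0%N) s i).2.

Definition jordan_mx (s : seq (F * nat)) :
    'M[F]_(\sum_(i < size s) jordan_size i) :=
  \mxdiag_(i < size s) jordan_block (nth (0, 0%N) s i).1 (jordan_size i).

(* The base change matrix [P] is formally rectangular to avoid a cast; being
   both row-free and row-full, it is square and invertible. *)
Definition has_jordan_form n (A : 'M[F]_n) (s : seq (F * nat)) : Prop :=
  all (fun b => 0 < b.2)%N s /\
  exists P : 'M[F]_(n, \sum_(i < size s) jordan_size i),
    [/\ row_free P, row_full P & A *m P = P *m jordan_mx s].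

(* As the Jordan blocks may be listed in any order, so may the elementary
   divisors: [ds] is used as a multiset. *)
Definition elementary_divisors n (A : 'M[F]_n) (ds : seq {poly F}) : Prop :=
  exists s : seq (F * nat),
    has_jordan_form A s /\ ds = [seq ('X - b.1%:P) ^+ b.2 | b <- s].

(* The endomorphism [x |-> A x] of the space of column vectors. *)
Definition mxend n (A : 'M[F]_n) : 'End('cV[F]_n) :=
  linfun (mulmx A : 'cV[F]_n -> 'cV[F]_n).

Definition half_space n (A : 'M[F]_n) (ms : seq nat) : {vspace 'cV[F]_n} :=
  (\sum_(a <- ms) (limg (mxend (A ^+ a)) :&: lker (mxend (A ^+ a))))%VS.

End JordanForm.

Section Riccati.
Variable C : numClosedFieldType.

(* On [C], [0 <= z] entails that [z] is real. *)
Definition possemidefmx m (D : 'M[C]_m) : Prop :=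
  forall x : 'cV[C]_m, 0 <= (x ^t* *m D *m x) 0 0.

Definition controllable m (A B : 'M[C]_m) : Prop :=
  \rank (\mxrow_(i < m) (A ^+ i *m B)) = m.

Definition hamiltonian m (F D Q : 'M[C]_m) : 'M[C]_(m + m) :=
  block_mx F (- D) (- Q) (- F ^t*).

Definition riccati_solution m (F D Q X : 'M[C]_m) : Prop :=
  Q + F ^t* *m X + X *m F - X *m D *m X = 0.

End Riccati.

(* Main.v *)
(* Let J be the standard symplectic matrix, so that J H is skew for the
   adjoint: H^* J = - J H.  Moving powers of H across the form x^* J y shows
   that W is isotropic, hence dim W <= m; the lower halves of the Jordan chains
   (of lengths 2 m_i) lie in W, hence dim W >= m.  If H (Y; Z) = (Y; Z) T, then
   isotropy and D >= 0 make Z (Ker Y) a subspace stable under F^* and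
   annihilated by D, which controllability forces to vanish; so Y is invertible.
   Uniqueness follows from nilpotency of the closed loop matrix F - D X. *)

Require Import Defs.
From HB Require Import structures.
From mathcomp Require Import all_boot all_order all_algebra.
From mathcomp Require Import complex.
From mathcomp Require Import reals.
From mathcomp Require Import ring.

Set Implicit Arguments.
Unset Strict Implicit.
Unset Printing Implicit Defensive.

Import Order.TTheory GRing.Theory Num.Theory.
Local Open Scope ring_scope.

(** * Conjugate transposes, semidefinite forms and controllability *)

Section Adjoint.
Local Open Scope sesquilinear_scope.
Variable C : numClosedFieldType.

Lemma trmxC_mul m n p (A : 'M[C]_(m, n)) (B : 'M[C]_(n, p)) :
  (A *m B) ^t* = B ^t* *m A ^t*.
Proof. by rewrite trmx_mul map_mxM. Qed.

Lemma trmxC0 m n : (0 : 'M[C]_(m, n)) ^t* = 0.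
Proof. by rewrite trmx0 map_mx0. Qed.

Lemma trmxCD m n (A B : 'M[C]_(m, n)) : (A + B) ^t* = A ^t* + B ^t*.
Proof. by rewrite linearD map_mxD. Qed.

Lemma trmxCZ m n a (A : 'M[C]_(m, n)) : (a *: A) ^t* = a^* *: A ^t*.
Proof. by rewrite linearZ map_mxZ. Qed.

Lemma trmxCN m n (A : 'M[C]_(m, n)) : (- A) ^t* = - A ^t*.
Proof. by rewrite linearN map_mxN. Qed.

Lemma hermsymmxE n (A : 'M[C]_n) : (A \is hermsymmx) = (A ^t* == A).
Proof. by rewrite is_hermitianmxE expr0 scale1r eq_sym. Qed.

Lemma mul_trmxC_eq0 n (x : 'cV[C]_n) : (x ^t* *m x) 0 0 = 0 -> x = 0.
Proof.
rewrite mxE => /eqP.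
under eq_bigr => i _ do rewrite !mxE mulrC -normCK.
rewrite psumr_eq0 => [/allP x0|i _]; last exact: exprn_ge0.
apply/colP => i; rewrite mxE.
by have := x0 i (mem_index_enum i); rewrite /= expf_eq0 /= normr_eq0 => /eqP.
Qed.

Lemma mul_trmxC_ge0 n (x : 'cV[C]_n) : 0 <= (x ^t* *m x) 0 0.
Proof.
rewrite mxE; apply: sumr_ge0 => i _.
by rewrite !mxE mulrC -normCK exprn_ge0.
Qed.

(* With [y = D x], [c = y^* y] and [b = y^* D y], the form of [D] at
   [(b + 1) x - c y] equals [- c^2 (b + 2)], so that [c = 0]. *)
Lemma possemidef_kernel n (D : 'M[C]_n) (x : 'cV[C]_n) :
  D \is hermsymmx -> possemidefmx D ->
  x ^t* *m D *m x = 0 -> D *m x = 0.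
Proof.
rewrite hermsymmxE => /eqP Dh Dp xDx; set y := D *m x.
have xDy : x ^t* *m D = y ^t* by rewrite trmxC_mul Dh.
pose c := (y ^t* *m y) 0 0; pose b := (y ^t* *m D *m y) 0 0.
have c0 : 0 <= c by exact: mul_trmxC_ge0.
have b0 : 0 <= b by exact: Dp.
have conj_c : c^* = c by exact: CrealP (ger0_real c0).
have conj_b : (b + 1)^* = b + 1.
  by rewrite rmorphD rmorph1; congr (_ + 1); exact: CrealP (ger0_real b0).
have := Dp ((b + 1) *: x - c *: y).
have -> : ((b + 1) *: x - c *: y) ^t* = (b + 1) *: x ^t* - c *: y ^t*.
  by rewrite trmxCD trmxCN !trmxCZ conj_c conj_b.
rewrite mulmxBl -!scalemxAl mulmxBl !mulmxBr -!scalemxAl -!scalemxAr xDx xDy.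
rewrite -(mulmxA (y ^t*)) -/y.
have -> : ((b + 1) *: ((b + 1) *: 0) - (b + 1) *: (c *: (y ^t* *m y)) -
    (c *: ((b + 1) *: (y ^t* *m y)) - c *: (c *: (y ^t* *m D *m y)))) 0 0 =
    - (c ^+ 2 * (b + 2)).
  have cE : c = (y ^t* *m y) 0 0 by [].
  have bE : b = (y ^t* *m D *m y) 0 0 by [].
  rewrite mxE in cE; rewrite mxE in bE.
  by rewrite !mxE -cE -bE; ring.
have b2 : 0 < b + 2 by rewrite ltr_wpDl.
rewrite oppr_ge0 pmulr_lle0 // => cle0.
have : c ^+ 2 == 0 by rewrite eq_le cle0 exprn_ge0.
by rewrite expf_eq0 => /eqP /mul_trmxC_eq0.
Qed.

(** Such a [w ^t*] kills on the left a matrix of full row rank [n], so the rank inequality for a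
    zero product leaves rank 0 for [w ^t*]. *)
Lemma controllable_eq0 n (A B : 'M[C]_n) (w : 'cV[C]_n) :
  controllable A B -> (forall k, w ^t* *m A ^+ k *m B = 0) -> w = 0.
Proof.
move=> cAB w0.
have : w ^t* *m \mxrow_(i < n) (A ^+ i *m B) = 0.
  rewrite mul_mxrow -[RHS]mxrow0; apply: eq_mxrow => i.
  by rewrite mulmxA w0.
move=> /mulmx0_rank_max; rewrite cAB -[leqRHS]add0n leq_add2r leqn0 mxrank_eq0.
by move=> /eqP /(congr1 (fun M => M ^t*)); rewrite trmxCK trmxC0.
Qed.

Lemma unitmx_kernel0 n (A : 'M[C]_n) :
  (forall x : 'cV[C]_n, A *m x = 0 -> x = 0) -> A \in unitmx.
Proof.
move=> A0; rewrite -unitmx_tr -row_free_unit; apply: inj_row_free => v vA.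
apply: trmx_inj; rewrite trmx0; apply: A0.
by apply: trmx_inj; rewrite trmx_mul trmxK vA trmx0.
Qed.

(** * Invariant Lagrangian subspaces and the Riccati solutions they give *)

Section Lagrangian.
Variables (m : nat) (F D Q Y Z T : 'M[C]_m).
Hypotheses (Dh : D \is hermsymmx) (Dp : possemidefmx D).
Hypothesis cFD : controllable F D.
Hypothesis YZinj : forall x : 'cV[C]_m, Y *m x = 0 -> Z *m x = 0 -> x = 0.
Hypothesis YZh : Y ^t* *m Z = Z ^t* *m Y.
Hypothesis YT : F *m Y - D *m Z = Y *m T.
Hypothesis ZT : - (Q *m Y) - F ^t* *m Z = Z *m T.

(** At [x] in Ker Y the first block row gives Y T x = - D Z x. By isotropy (Z x)^* Y T x = (Y x)^* Z
    T x = 0, so the form of [D] vanishes at Z x. Thus Ker Y is stable under [T], and there [Z]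
    intertwines [T] with - F^*. *)
Lemma kernel_top (x : 'cV[C]_m) :
  Y *m x = 0 ->
  [/\ D *m (Z *m x) = 0, Y *m (T *m x) = 0 &
      Z *m (T *m x) = - (F ^t* *m (Z *m x))].
Proof.
move=> Yx.
have YTx : Y *m (T *m x) = - (D *m (Z *m x)).
  by rewrite mulmxA -YT mulmxBl -!mulmxA Yx mulmx0 sub0r.
have DZx : D *m (Z *m x) = 0.
  apply: possemidef_kernel => //.
  have : (Y *m x) ^t* *m (Z *m (T *m x)) = 0 by rewrite Yx trmxC0 mul0mx.
  rewrite trmxC_mul -mulmxA (mulmxA _ Z) YZh -(mulmxA _ Y) YTx !mulmxN.
  by rewrite trmxC_mul !mulmxA => /eqP; rewrite oppr_eq0 => /eqP.
split=> //; first by rewrite YTx DZx oppr0.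
by rewrite mulmxA -ZT mulmxBl mulNmx -!mulmxA Yx mulmx0 oppr0 sub0r.
Qed.

(** For [x] in Ker Y, (Z x)^* F^(k+1) D = - (Z T x)^* F^k D with T x again in Ker Y. By induction on
    [k], for all such [x], these products vanish; controllability gives Z x = 0. *)
Lemma top_unitmx : Y \in unitmx.
Proof.
apply: unitmx_kernel0 => x Yx.
have Dh' : D ^t* = D by apply/eqP; rewrite -hermsymmxE.
apply: YZinj => //; apply: (controllable_eq0 cFD) => k.
elim: k x Yx => [|k IHk] x Yx; have [DZ YTx ZTx] := kernel_top Yx.
  by rewrite expr0 mulmx1 -Dh' -trmxC_mul DZ trmxC0.
have := IHk _ YTx; rewrite ZTx trmxCN trmxC_mul trmxCK !mulNmx => /eqP.
by rewrite oppr_eq0 exprS -mulmxE !mulmxA => /eqP.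
Qed.

Let X := Z *m invmx Y.

(** Multiplying X^* = X by Y^* on the left and [Y] on the right turns it into the isotropy relation
    [YZh]. *)
Lemma lagrangian_hermitian : X \is hermsymmx.
Proof.
have YU := top_unitmx.
rewrite hermsymmxE /X; apply/eqP.
have YcU : Y ^t* \in unitmx by rewrite map_unitmx unitmx_tr.
apply: (can_inj (mulKmx YcU)); apply: (can_inj (mulmxK YU)).
rewrite -trmxC_mul mulmxKV // -mulmxA mulmxKV //.
Qed.

(** The closed loop matrix is similar to [T], hence inherits its nilpotency. *)
Lemma closed_loop : F - D *m X = Y *m T *m invmx Y.
Proof. by rewrite -YT mulmxBl mulmxK ?top_unitmx // mulmxA. Qed.

Lemma closed_loop_nilpotent N : T ^+ N = 0 -> (F - D *m X) ^+ N = 0.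
Proof.
move=> TN; have YU := top_unitmx; rewrite closed_loop.
suff -> : (Y *m T *m invmx Y) ^+ N = Y *m T ^+ N *m invmx Y.
  by rewrite TN mulmx0 mul0mx.
elim: (N) => [|k IHk]; first by rewrite !expr0 mulmx1 mulmxV.
by rewrite exprSr IHk -mulmxE !mulmxA mulmxKV // -(mulmxA Y) mulmxE -exprSr.
Qed.

(** The second block row times Y^-1 reads - Q - F^* X = Z T Y^-1 = X (F - D X), which is the Riccati
    equation. *)
Lemma lagrangian_riccati : riccati_solution F D Q X.
Proof.
have YU := top_unitmx.
have : - Q - F ^t* *m X = X *m (F - D *m X).
  rewrite closed_loop /X !mulmxA mulmxKV // -ZT mulmxBl mulNmx.
  by rewrite mulmxK // mulmxA.
move=> /eqP; rewrite -subr_eq0 => /eqP E; rewrite /riccati_solution.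
rewrite -[LHS]opprK -[RHS]oppr0 -E; congr (- _).
by rewrite mulmxBr (mulmxA X D X) !opprD !opprK !addrA.
Qed.
End Lagrangian.

(** * Uniqueness of the hermitian solution *)

(** The last nonzero vector among the A^k w lies in Ker A. *)
Lemma nilp_kernel n (A : 'M[C]_n) N (w : 'cV[C]_n) :
  A ^+ N = 0 -> w != 0 ->
  exists k, A ^+ k *m w != 0 /\ A *m (A ^+ k *m w) = 0.
Proof.
move=> AN w0.
have ex : exists k, A ^+ k *m w == 0 by exists N; rewrite AN mul0mx.
case: (ex_minnP ex) => -[|k] /eqP Ak mink.
  by rewrite expr0 mul1mx in Ak; rewrite Ak eqxx in w0.
exists k; split; first by apply/negP => /mink; rewrite ltnn.
by rewrite mulmxA mulmxE -exprS.
Qed.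

Lemma trmxC_exp n (A : 'M[C]_n) k : (A ^+ k) ^t* = (A ^t*) ^+ k.
Proof.
elim: k => [|k IHk]; first by rewrite !expr0 trmx1 map_mx1.
by rewrite exprS -mulmxE trmxC_mul IHk mulmxE -exprSr.
Qed.

(* The difference [E = X' - X] satisfies
   [A^* E + E A = E D E] with [A = F - D X], so [A^* E = - E A'] and [A^*]
   preserves the image of [E]. If [E != 0], [A^*] kills some [w = E v != 0];
   then [w^* D w = 0], hence [D w = 0] and [F^* w = 0]: contradiction. *)
Lemma riccati_uniq m (F D Q X X' : 'M[C]_m) N :
  D \is hermsymmx -> possemidefmx D -> controllable F D ->
  X \is hermsymmx -> X' \is hermsymmx ->
  riccati_solution F D Q X -> riccati_solution F D Q X' ->
  (F - D *m X) ^+ N = 0 -> X' = X.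
Proof.
rewrite /riccati_solution => Dh Dp cFD.
rewrite !hermsymmxE => /eqP Xh /eqP X'h RX RX' AN.
have Dh' := Dh; rewrite hermsymmxE in Dh'; move/eqP: Dh' => Dh'.
pose E := X' - X; pose A := F - D *m X; pose A' := F - D *m X'.
have Eh : E ^t* = E by rewrite trmxCD trmxCN Xh X'h.
have Ac : A ^t* = F ^t* - X *m D by rewrite trmxCD trmxCN trmxC_mul Xh Dh'.
have lyap : A ^t* *m E + E *m A = E *m D *m E.
  apply/eqP; rewrite -subr_eq0; apply/eqP; rewrite -[RHS](subrr 0) -{1}RX' -RX.
  rewrite Ac /A /E !(mulmxBl, mulmxBr) !mulmxA.
  move: (F ^t* *m X) (F ^t* *m X') (X *m F) (X' *m F).
  move: (X *m D *m X) (X *m D *m X') (X' *m D *m X) (X' *m D *m X').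
  by move=> *; apply/matrixP => i j; rewrite !mxE; ring.
have stab : A ^t* *m E = E *m - A'.
  have -> : A' = A - D *m E by rewrite /A' /A /E mulmxBr opprB addrA addrNK.
  by rewrite opprB (mulmxBr E (D *m E)) (mulmxA E D) -lyap addrK.
have stabX k : (A ^t*) ^+ k *m E = E *m (- A') ^+ k.
  elim: k => [|k IHk]; first by rewrite !expr0 mul1mx mulmx1.
  by rewrite exprSr -mulmxE -mulmxA stab mulmxA IHk -mulmxA mulmxE -exprSr.
apply/eqP; rewrite -subr_eq0 -/E; apply/negPn/negP => E0.
have [j Ej0] : exists j, col j E != 0.
  apply/existsP; apply: contraR E0; rewrite negb_exists => /forallP E0.
  apply/eqP/matrixP => i j; rewrite mxE.
  by move: (E0 j); rewrite negbK => /eqP/colP/(_ i); rewrite !mxE.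
have AcN : (A ^t*) ^+ N = 0 by rewrite -trmxC_exp AN trmxC0.
have [k [w0 Aw]] := nilp_kernel AcN Ej0.
move: w0 Aw; rewrite [col j E]colE mulmxA stabX -mulmxA.
move: (_ *m delta_mx j 0) => v w0 Aw.
have vEA : (E *m v) ^t* *m A = 0.
  by rewrite -[A]trmxCK -trmxC_mul Aw trmxC0.
have Dw : D *m (E *m v) = 0.
  apply: possemidef_kernel => //.
  (* By [lyap], w^* D w = v^* A^* E v + v^* E A v, and both terms vanish because A^* E v = 0. *)
  rewrite trmxC_mul Eh -!mulmxA (mulmxA E D) (mulmxA _ E v) -lyap mulmxDl.
  rewrite mulmxDr -!mulmxA Aw mulmx0 add0r.
  by rewrite mulmxA -[in X in X *m _]Eh -trmxC_mul mulmxA vEA mul0mx.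
have wD : (E *m v) ^t* *m D = 0 by rewrite -Dh' -trmxC_mul Dw trmxC0.
have wF : (E *m v) ^t* *m F = 0.
  have -> : F = A + D *m X by rewrite addrNK.
  by rewrite mulmxDr vEA mulmxA wD mul0mx addr0.
case/negP: w0; apply/eqP; apply: (controllable_eq0 cFD) => i.
case: i => [|i]; first by rewrite expr0 mulmx1.
by rewrite exprS -mulmxE mulmxA wF !mul0mx.
Qed.

End Adjoint.

(** * Half spaces, Jordan chains and the lower bound for the dimension *)

Section JordanChains.
Variable K : fieldType.

Lemma mxendE n (A : 'M[K]_n) (v : 'cV_n) : mxend A v = A *m v.
Proof. by rewrite lfunE. Qed.

Lemma free_colsP n d (P : 'M[K]_(n, d)) :
  free [tuple col j P | j < d] <-> forall x : 'cV_d, P *m x = 0 -> x = 0.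
Proof.
have PE (x : 'cV_d) : P *m x = \sum_(j < d) x j 0 *: [tuple col j P | j < d]`_j.
  apply/colP => i; rewrite mxE summxE; apply: eq_bigr => j _.
  by rewrite -tnth_nth tnth_mktuple !mxE mulrC.
split=> [/freeP Pfree x Px|Pinj].
  apply/colP => i; rewrite mxE.
  by apply: (Pfree (fun j => x j 0)); rewrite -PE.
apply/freeP => f f0 i; have := Pinj (\col_j f j).
have -> : P *m (\col_j f j) = 0.
  by rewrite PE -[RHS]f0; apply: eq_bigr => j _; rewrite mxE.
by move=> /(_ erefl)/colP/(_ i); rewrite !mxE.
Qed.

Lemma mem_half_space n (A : 'M[K]_n) ms a u :
  a \in ms -> A ^+ a *m (A ^+ a *m u) = 0 -> A ^+ a *m u \in half_space A ms.
Proof.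
move=> ams Au.
have: A ^+ a *m u \in (limg (mxend (A ^+ a)) :&: lker (mxend (A ^+ a)))%VS.
  by rewrite memv_cap memv_ker mxendE Au eqxx andbT -mxendE memv_img ?memvf.
by apply: subvP; rewrite /half_space (big_rem a ams) addvSl.
Qed.

(** Closure under addition suffices: every element of a summand already has the form A^a u with
    A^(2a) u = 0. *)
Lemma half_space_ind n (A : 'M[K]_n) ms (Pr : 'cV[K]_n -> Prop) :
  Pr 0 -> (forall u v, Pr u -> Pr v -> Pr (u + v)) ->
  (forall a u, a \in ms -> A ^+ a *m (A ^+ a *m u) = 0 -> Pr (A ^+ a *m u)) ->
  forall v, v \in half_space A ms -> Pr v.
Proof.
move=> Pr0 PrD PrA; rewrite /half_space big_seq.
elim/big_rec: _ => [v|a V ams IHV v]; first by rewrite memv0 => /eqP ->.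
case/memv_addP => x /memv_capP[/memv_imgP[u _ ->]]; rewrite memv_ker !mxendE.
by move=> /eqP Au [y /IHV Pry ->]; apply: PrD => //; exact: PrA.
Qed.

(** [A] commutes with its powers, so it sends A^a u to A^a (A u), which lies in the same summand. *)
Lemma half_space_stable n (A : 'M[K]_n) ms :
  (mxend A @: half_space A ms <= half_space A ms)%VS.
Proof.
apply/subvP => _ /memv_imgP[v vW ->]; rewrite mxendE; elim/half_space_ind: vW.
- by rewrite mulmx0 mem0v.
- by move=> u w uW wW; rewrite mulmxDr memvD.
move=> a u ams Au.
have AC (x : 'cV_n) : A *m (A ^+ a *m x) = A ^+ a *m (A *m x).
  by rewrite !mulmxA !mulmxE -exprS -exprSr.
by rewrite AC mem_half_space // -!AC Au mulmx0.
Qed.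

Section Chain.
Variables (n d : nat) (A : 'M[K]_n) (P : 'M[K]_(n, d)).
Hypothesis AP : A *m P = P *m jordan_block 0 d.

(** The sum has one term, the previous column, or none when j = 0; this form avoids a case split on
    the predecessor. *)
Lemma mul_col_jordan (j : 'I_d) :
  A *m col j P = \sum_(i < d | i.+1 == j) col i P.
Proof.
rewrite colE mulmxA AP -mulmxA -colE; apply/colP => i.
rewrite !mxE summxE [RHS]big_mkcond /=; apply: eq_bigr => k _.
by rewrite !mxE mul0rn add0r; case: eqP => _; rewrite ?mulr1 ?mulr0.
Qed.

Lemma chain_shift k (i j : 'I_d) :
  (j = i + k :> nat)%N -> A ^+ k *m col j P = col i P.
Proof.
elim: k i j => [|k IHk] i j jE.
  rewrite expr0 mul1mx; congr (col _ _).
  by apply: val_inj; rewrite /= jE addn0.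
have lt_i : (i.+1 < d)%N.
  by apply: leq_ltn_trans (ltn_ord j); rewrite jE addnS ltnS leq_addr.
rewrite exprS -mulmxE -mulmxA (IHk (Ordinal lt_i)); last by rewrite jE addnS.
by rewrite mul_col_jordan (big_pred1 i).
Qed.

Lemma chain_end k (j : 'I_d) : (j < k)%N -> A ^+ k *m col j P = 0.
Proof.
(* After [j] applications column 0 is reached, and one more gives 0. *)
move=> jk; rewrite -(subnK jk) exprD exprS.
have lt0 : (0 < d)%N by apply: leq_ltn_trans (ltn_ord j).
rewrite -!mulmxE -!mulmxA (@chain_shift _ (Ordinal lt0) j) // mul_col_jordan.
by rewrite big_pred0 ?mulmx0 // => i; rewrite -[X in _ == X]/0%N.
Qed.
End Chain.

(** Degrees give the block size; evaluation at the eigenvalue, a root since the block is nonempty,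
    forces it to be 0. *)
Lemma half_expX_XsubC (a : nat) (b : K * nat) :
  (0 < b.2)%N -> ('X - b.1%:P) ^+ b.2 = 'X^(2 * a) -> b = (0, a.*2).
Proof.
case: b => c d /= d0 E.
have dE : d = a.*2.
  have := congr1 (fun p : {poly K} => size p) E.
  by rewrite size_exp_XsubC size_polyXn mul2n => -[].
congr (_, _) => //; apply/eqP.
have := congr1 (fun p : {poly K} => p.[c]) E.
rewrite !horner_exp !hornerE subrr expr0n eqn0Ngt d0 /= => /esym/eqP.
by rewrite expf_eq0 => /andP[].
Qed.

(** Restates the Jordan form by chains: each block column of the base change matrix is a chain for
    the eigenvalue 0, of even length. *)
Lemma elementary_divisors_chains n (A : 'M[K]_n) ms :
  elementary_divisors A [seq 'X^(2 * a) | a <- ms] ->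
  exists k (d : 'I_k -> nat) (P : 'M[K]_(n, \sum_(i < k) (d i))),
    [/\ row_free P, row_full P &
        forall i, [/\ (d i)./2 \in ms, ~~ odd (d i) &
          A *m submxrow P i = submxrow P i *m jordan_block 0 (d i)]].
Proof.
case=> s [[s_gt0 [P [Pfree Pfull AP]]] sE].
have es : s = [seq (0, a.*2) | a <- ms].
  elim: s ms s_gt0 {P Pfree Pfull AP} sE => [|b s IHs] [|a ms] //= /andP[b0 s0].
  by case=> /esym bE /IHs <- //; rewrite (half_expX_XsubC b0 bE).
exists (size s), (@jordan_size K s), P; split=> // i.
have [bs b0] : (jordan_size i)./2 \in ms /\
    nth (0, 0%N) s i = (0, (jordan_size i)./2.*2).
  rewrite /jordan_size; have := mem_nth (0, 0%N) (ltn_ord i).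
  rewrite [X in _ \in X]es => /mapP[a ams ->] /=.
  by rewrite doubleK.
have dE : jordan_size i = (jordan_size i)./2.*2 by rewrite {1}/jordan_size b0.
split=> //; first by rewrite dE odd_double.
have E0 : (nth (0, 0%N) s i).1 = 0 by rewrite b0.
rewrite -E0; move: AP.
rewrite -{1 2}[P]submxrowK mul_mxrow /jordan_mx mul_mxrow_mxdiag.
by move=> /eq_mxrowP/(_ i).
Qed.

Lemma elementary_divisors_nilpotent n (A : 'M[K]_n) ms :
  elementary_divisors A [seq 'X^(2 * a) | a <- ms] -> exists N, A ^+ N = 0.
Proof.
case/elementary_divisors_chains => k [d [P [Pfree Pfull AP]]].
(* The length of the longest chain: this power kills every column of [P]. *)
pose N := (\max_(i < k) d i)%N; exists N.
suff AP0 : A ^+ N *m P = 0.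
  by apply: (row_free_inj Pfree); rewrite AP0 mul0mx.
rewrite -[P]submxrowK mul_mxrow -[RHS]mxrow0; apply: eq_mxrow => i.
apply/matrixP => r j; have [_ _ /chain_end AP0] := AP i.
have := AP0 N j (leq_trans (ltn_ord j) (leq_bigmax i)).
by rewrite colE mulmxA -colE => /colP/(_ r); rewrite !mxE.
Qed.

(** The first half of every chain lies in the half space. These columns of an invertible matrix are
    free, and their number is half of [n]. *)
Lemma half_space_dim_ge n (A : 'M[K]_n) ms :
  elementary_divisors A [seq 'X^(2 * a) | a <- ms] ->
  (n <= (\dim (half_space A ms)).*2)%N.
Proof.
case/elementary_divisors_chains => k [d [P [Pfree Pfull AP]]].
have dn : (\sum_(i < k) d i = n)%N.
  by move/eqP: Pfull => <-; move/eqP: Pfree => ->.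
(* [tagnat.sig1] is the block of a column and [tagnat.sig2] its position in that block. *)
pose half (t : 'I_(\sum_(i < k) d i)) := (tagnat.sig2 t < (d (tagnat.sig1 t))./2)%N.
pose S := [seq t <- enum 'I_(\sum_(i < k) d i) | half t].
have Pcol : free [seq col t P | t <- enum 'I_(\sum_(i < k) d i)].
  have /free_colsP : forall x : 'cV_(\sum_(i < k) d i), P *m x = 0 -> x = 0.
    by move=> x Px; apply: (row_full_inj Pfull); rewrite Px mulmx0.
  by rewrite /= enumT.
have Sfree : free [seq col t P | t <- S].
  have := filter_subseq half (enum 'I_(\sum_(i < k) d i)).
  move=> /(map_subseq (fun t => col t P)) Scol.
  by rewrite -/S in Scol; rewrite (subseq_uniqP (free_uniq Pcol) Scol) filter_free.
have SW : (<<[seq col t P | t <- S]>> <= half_space A ms)%VS.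
  apply/span_subvP => v /mapP[t]; rewrite mem_filter => /andP[half_t _] -> {v}.
  rewrite /half in half_t.
  have -> : col t P = col (tagnat.sig2 t) (submxrow P (tagnat.sig1 t)).
    by apply/colP => r; rewrite !mxE tagnat.sig2K.
  have [ams odd_d chain] := AP (tagnat.sig1 t).
  have dE : (d (tagnat.sig1 t) =
      (d (tagnat.sig1 t))./2 + (d (tagnat.sig1 t))./2)%N.
    by rewrite addnn even_halfK.
  have lt_d : (tagnat.sig2 t + (d (tagnat.sig1 t))./2 < d (tagnat.sig1 t))%N.
    by rewrite [ltnRHS]dE ltn_add2r.
  (* With a half the length of the chain, column j < a is A^a applied to column j + a, and A^a kills
     column j. *)
  rewrite -(chain_shift chain (j := Ordinal lt_d)
    (k := (d (tagnat.sig1 t))./2)) // mem_half_space //.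
  by rewrite (chain_shift chain (i := tagnat.sig2 t)) // (chain_end chain).
have := dimvS SW; rewrite (eqnP Sfree) size_map -leq_double; apply: leq_trans.
rewrite size_filter -sum1_count big_enum_cond /=.
have -> : (\sum_(t | half t) 1 = \sum_(i < k) (d i)./2)%N.
  transitivity (\sum_(i < k) \sum_(j < d i | j < (d i)./2) 1)%N.
    by rewrite sig_big_dep (reindex tagnat.sig) //; exact: onW_bij tagnat.sig_bij.
  apply: eq_bigr => i _; rewrite -(big_ord_widen (d i) (fun=> 1%N)) ?sum1_card ?card_ord //.
  by rewrite leq_half_double leqW // -addnn leq_addr.
rewrite -[leqLHS]dn -mul2n big_distrr /= leq_sum // => i _.
by have [_ odd_d _] := AP i; rewrite mul2n even_halfK.
Qed.

End JordanChains.

(** * Isotropy of the half space and the upper bound for its dimension *)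

Section HalfSpaceOfHamiltonian.
Local Open Scope sesquilinear_scope.
Variables (C : numClosedFieldType) (m : nat) (F D Q : 'M[C]_m).
Hypotheses (Dh : D \is hermsymmx) (Qh : Q \is hermsymmx).

Definition symplectic : 'M[C]_(m + m) := block_mx 0 1%:M (- 1%:M) 0.

Let H := hamiltonian F D Q.

Lemma symplectic_unit : symplectic \in unitmx.
Proof.
have /mulmx1_unit [] // : symplectic *m block_mx 0 (- 1%:M) 1%:M 0 = 1%:M.
rewrite mulmx_block !mul0mx !mulmx0 !mulNmx !mulmxN !mulmx1 opprK.
by rewrite !addr0 !add0r scalar_mx_block.
Qed.

Lemma hamiltonian_skew : H ^t* *m symplectic = - (symplectic *m H).
Proof.
move: Dh Qh; rewrite !hermsymmxE => /eqP Dh' /eqP Qh'.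
rewrite /H /hamiltonian tr_block_mx map_block_mx !trmxCN Dh' Qh' trmxCK.
apply/eqP; rewrite -addr_eq0 !mulmx_block add_block_mx.
rewrite !mul0mx !mulmx0 !mulNmx !mulmxN !mul1mx !mulmx1 !addr0 !add0r !opprK.
by rewrite !(addNr, addrN) block_mx0.
Qed.

Lemma hamiltonian_exp_skew k :
  (H ^+ k) ^t* *m symplectic = (-1) ^+ k *: (symplectic *m H ^+ k).
Proof.
elim: k => [|k IHk].
  by rewrite !expr0 scale1r trmx1 map_mx1 mul1mx mulmx1.
rewrite {1}exprS -mulmxE trmxC_mul -mulmxA hamiltonian_skew mulmxN mulmxA IHk.
by rewrite -scalemxAl -scaleNr -mulmxA mulmxE -exprSr [(-1) ^+ k.+1]exprS mulN1r.
Qed.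

(* For [x = H^a u] and [y = H^b v] with [H^a x = 0 = H^b y], moving [H^a]
   (if [b <= a]) or [H^b] (if [a <= b]) across the form kills it. *)
Lemma half_space_isotropic ms u v :
  u \in half_space H ms -> v \in half_space H ms ->
  u ^t* *m symplectic *m v = 0.
Proof.
move=> uW vW; elim/half_space_ind: uW.
- by rewrite trmxC0 !mul0mx.
- by move=> x y x0 y0; rewrite trmxCD !mulmxDl x0 y0 addr0.
move=> a x _ Hx; elim/half_space_ind: vW.
- by rewrite mulmx0.
- by move=> y z y0 z0; rewrite mulmxDr y0 z0 addr0.
move=> b y _ Hy.
have kill c c' (z : 'cV_(m + m)) :
    (c' <= c)%N -> H ^+ c' *m z = 0 -> H ^+ c *m z = 0.
  by move=> le_c z0; rewrite -(subnK le_c) exprD -mulmxE -mulmxA z0 mulmx0.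
case: (leqP b a) => [ba|/ltnW ab].
  rewrite trmxC_mul -(mulmxA (x ^t*)) hamiltonian_exp_skew -scalemxAr -scalemxAl.
  by rewrite -!mulmxA (kill _ _ _ ba Hy) !mulmx0 scaler0.
rewrite -mulmxA (mulmxA symplectic).
have -> : symplectic *m H ^+ b = (-1) ^+ b *: ((H ^+ b) ^t* *m symplectic).
  by rewrite hamiltonian_exp_skew scalerA -expr2 sqrr_sign scale1r.
rewrite -scalemxAl -scalemxAr !mulmxA -trmxC_mul (kill _ _ _ ab Hx).
by rewrite trmxC0 !mul0mx scaler0.
Qed.

Lemma isotropic_cols n (B : 'M[C]_(m + m, n)) ms :
  (forall j, col j B \in half_space H ms) -> B ^t* *m symplectic *m B = 0.
Proof.
move=> BW; apply/matrixP => i j; rewrite [RHS]mxE.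
have := half_space_isotropic (BW i) (BW j) => /matrixP/(_ 0 0).
rewrite [RHS]mxE => <-.
rewrite tr_col map_row -row_mul [LHS]mxE [RHS]mxE; apply: eq_bigr => k _.
by rewrite [row _ _ _ _]mxE [col _ _ _ _]mxE.
Qed.

(** For B = (Y; Z), B^* J B = Y^* Z - Z^* Y. *)
Lemma half_space_symm (Y Z : 'M[C]_m) ms :
  (forall j, col j (col_mx Y Z) \in half_space H ms) -> Y ^t* *m Z = Z ^t* *m Y.
Proof.
move=> /isotropic_cols; rewrite tr_col_mx map_row_mx mul_row_block mul_row_col.
rewrite !mulmx0 mulmxN !mulmx1 addr0 add0r mulNmx addrC => /eqP.
by rewrite subr_eq0 => /eqP.
Qed.

(** With a basis of W as the columns of [B], B^* J B = 0 gives rank (B^* J) + rank B <= 2m, and both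
    ranks equal dim W since J is invertible. *)
Lemma half_space_dim_le ms : ((\dim (half_space H ms)).*2 <= m + m)%N.
Proof.
pose W := half_space H ms.
pose B := \matrix_(i < m + m, j < \dim W) (tnth (vbasis W) j) i 0.
have BE j : col j B = tnth (vbasis W) j by apply/colP => i; rewrite !mxE.
have BW j : col j B \in half_space H ms by rewrite BE vbasis_mem // mem_tnth.
have Bfree : \rank B = \dim W.
  rewrite -mxrank_tr; apply/eqP; apply: inj_row_free => x Bx.
  apply: trmx_inj; rewrite trmx0.
  have /free_colsP : free [tuple col j B | j < \dim W].
    have -> : [tuple col j B | j < \dim W] = vbasis W.
      by apply: eq_from_tnth => j; rewrite tnth_mktuple BE.
    exact: basis_free (vbasisP W).
  by apply; apply: trmx_inj; rewrite trmx_mul trmxK Bx trmx0.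
have := mulmx0_rank_max (isotropic_cols BW).
rewrite mxrankMfree ?row_free_unit ?symplectic_unit //.
by rewrite mxrank_map mxrank_tr Bfree addnn.
Qed.

Lemma half_space_dim ms :
  elementary_divisors H [seq 'X^(2 * a) | a <- ms] -> \dim (half_space H ms) = m.
Proof.
move=> /half_space_dim_ge ge_m; apply: double_inj; apply/eqP.
by rewrite eqn_leq -[m.*2]addnn half_space_dim_le.
Qed.
End HalfSpaceOfHamiltonian.

(** * The Riccati solution read off from a basis of the half space *)

Theorem proposition3p1 (R : realType) (m : nat) (F D Q : 'M[R[i]]_m)
    (ms : seq nat) :
  let H := hamiltonian F D Q in
  let W := half_space H ms in
  D \is hermsymmx -> Q \is hermsymmx -> possemidefmx D ->
  controllable F D ->
  eigenvalue H =1 pred1 0 ->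
  elementary_divisors H [seq 'X^(2 * a) | a <- ms] ->
  [/\ (mxend H @: W <= W)%VS,
      \dim W = m &
      forall Y Z : 'M[R[i]]_m,
        basis_of W [tuple col j (col_mx Y Z) | j < m] ->
        Y \in unitmx /\
        (let X := Z *m invmx Y in
         [/\ X \is hermsymmx,
             riccati_solution F D Q X &
             forall X' : 'M[R[i]]_m,
               X' \is hermsymmx -> riccati_solution F D Q X' -> X' = X])].
Proof.
move=> H W Dh Qh Dp cFD _ edH.
have Wstable : (mxend H @: W <= W)%VS := half_space_stable H ms.
split; [exact: Wstable | exact: half_space_dim | move=> Y Z].
set B := col_mx Y Z => Wbasis.
have BW j : col j B \in W.
  rewrite -(span_basis Wbasis) memv_span //.
  by apply/tnthP; exists j; rewrite tnth_mktuple.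
have Binj : forall x : 'cV_m, B *m x = 0 -> x = 0.
  exact/free_colsP/(basis_free Wbasis).
(* [T] is the matrix of the restriction of [H] to [W] in the basis formed by the columns of [B]. *)
pose T : 'M_m :=
  \matrix_(i, j) coord [tuple col j B | j < m] i (H *m col j B).
have HB : H *m B = B *m T.
  apply/matrixP => i j.
  have HBj : H *m col j B \in W.
    by rewrite -mxendE; apply: (subvP Wstable); rewrite memv_img.
  have := coord_basis Wbasis HBj => /(congr1 (fun v : 'cV_(m + m) => v i 0)).
  have -> : (H *m col j B) i 0 = (H *m B) i j.
    by rewrite colE mulmxA -colE mxE.
  move=> ->; rewrite summxE mxE; apply: eq_bigr => k _.
  by rewrite -tnth_nth tnth_mktuple !mxE mulrC.
have HBk k : H ^+ k *m B = B *m T ^+ k.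
  elim: k => [|k IHk]; first by rewrite !expr0 mul1mx mulmx1.
  by rewrite exprS -mulmxE -mulmxA IHk mulmxA HB -mulmxA mulmxE -exprS.
have [N HN] := elementary_divisors_nilpotent edH.
(* B T^N = H^N B = 0, and [B] is injective. *)
have TN : T ^+ N = 0.
  apply/matrixP => i j; have := Binj (col j (T ^+ N)).
  rewrite !colE mulmxA -HBk HN !mul0mx -colE => /(_ erefl)/colP/(_ i).
  by rewrite !mxE.
have YZh := half_space_symm Dh Qh BW.
(* The two block rows of H B = B T. *)
have [YT ZT] : F *m Y - D *m Z = Y *m T /\
    - (Q *m Y) - map_mx Num.conj F^T *m Z = Z *m T.
  move: HB; rewrite mul_block_col mul_col_mx !mulNmx.
  by move=> /eq_col_mx.
have YZinj : forall x : 'cV_m, Y *m x = 0 -> Z *m x = 0 -> x = 0.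
  by move=> x Yx Zx; apply: Binj; rewrite mul_col_mx Yx Zx col_mx0.
have solX := lagrangian_riccati Dh Dp cFD YZinj YZh YT ZT.
have Xh := lagrangian_hermitian Dh Dp cFD YZinj YZh YT ZT.
have AN : (F - D *m (Z *m invmx Y)) ^+ N = 0.
  exact (closed_loop_nilpotent Dh Dp cFD YZinj YZh YT ZT TN).
split; first exact (top_unitmx Dh Dp cFD YZinj YZh YT ZT).
split; [exact Xh | exact solX | move=> X' X'h solX'].
exact (riccati_uniq Dh Dp cFD Xh X'h solX solX' AN).
Qed.
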